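(* Let $k, d_{\text{in}}, d_{\text{out}} \ge 1$ be integers and let $p_1,\dots,p_k \in [0,1)$ satisfy $\sum_{j=1}^k (1-p_j) \le 1$. Let $\Delta W_1,\dots,\Delta W_k \in \mathbb{R}^{d_{\text{out}}\times d_{\text{in}}}$ and $h \in \mathbb{R}^{d_{\text{in}}}$. Let $z^{(1)},\dots,z^{(k)}$ be random vectors with values in $\{0,1\}^{d_{\text{out}}}$ whose entries are independent with $z^{(1)}_s \sim \mathrm{Ber}(1-p_1)$ and, for $2 \le j \le k$, $$z^{(j)}_s \sim \mathrm{Ber}\!\left(\frac{1-p_j}{\left(\sum_{l=1}^{j-1}p_l\right)-(j-2)}\right), \qquad s \in \{1,\dots,d_{\text{out}}\}.$$ For $1\le j\le k$ put $$m^{(j)} = \left(\prod_{l=1}^{j-1}(\mathbf{1}-z^{(l)})\right)\odot z^{(j)} .$$ Then for any $i,j\in\{1,\dots,k\}$ with $i<j$, the vectors $m^{(j)}\odot(\Delta W_j h)$ and $m^{(i)}\odot(\Delta W_i h)$ in $\mathbb{R}^{d_{\text{out}}}$ are orthogonal, i.e. for every realization of the random vectors $z^{(1)},\dots,z^{(k)}$, $$\left(m^{(j)}\odot(\Delta W_j h)\right)^T\left(m^{(i)}\odot(\Delta W_i h)\right)=0 .$$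
   Context: Here $\odot$ denotes element-wise (Hadamard) multiplication of vectors, $\mathbf{1}$ is the all-ones vector in $\mathbb{R}^{d_{\text{out}}}$, the product $\prod_{l=1}^{j-1}(\mathbf{1}-z^{(l)})$ is taken element-wise (the empty product, for $j=1$, is $\mathbf{1}$), and $\mathrm{Ber}(q)$ is the Bernoulli distribution on $\{0,1\}$ with probability $q$ of the value $1$. The assumptions $p_j<1$ and $\sum_{j=1}^k(1-p_j)\le 1$ ensure that the denominators are positive and the Bernoulli parameters lie in $[0,1]$. The matrices $\Delta W_j$ are the (LoRA) update matrices of a linear layer, and $p_j$ is the dropout rate associated with $\Delta W_j$. *)

(* Defs.v *)
From HB Require Import structures.
From mathcomp Require Import all_boot all_order all_algebra.
From mathcomp Require Import all_classical all_reals all_analysis.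

Set Implicit Arguments.
Unset Strict Implicit.
Unset Printing Implicit Defensive.

Import Order.TTheory GRing.Theory Num.Theory.

Local Open Scope classical_set_scope.
Local Open Scope ring_scope.

Definition hadamard (R : pzRingType) (n : nat) (u v : 'cV[R]_n) : 'cV[R]_n :=
  map2_mx *%R u v.

Definition mutually_independent (d d' : measure_display)
    (T : measurableType d) (T' : measurableType d') (R : realType)
    (P : probability T R) (I : finType) (X : I -> {RV P >-> T'}) : Prop :=
  forall (J : {set I}) (A : I -> set T'),
    (forall i : I, i \in J -> measurable (A i)) ->
    P (\bigcap_(i in [set` J]) (X i @^-1` A i)) =
    (\prod_(i in J) P (X i @^-1` A i))%E.

(* Indices range over 'I_k, so the ordinal j stands for the index j.+1 of the
   usual numbering from 1; the offset "(index - 2)" thus reads j.+1%:R - 2. *)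
Definition mask_rate (R : realType) (k : nat) (p : 'I_k -> R) (j : 'I_k) : R :=
  if (j == 0 :> nat)%N then 1 - p j
  else (1 - p j) / (\sum_(l < k | (l < j)%N) p l - (j.+1%:R - 2)).

Definition dropout_mask (R : realType) (k n : nat) (z : 'I_k -> 'cV[R]_n) (j : 'I_k)
    : 'cV[R]_n :=
  hadamard
    (\big[@hadamard R n/const_mx 1]_(l < k | (l < j)%N) (const_mx 1 - z l))
    (z j).

Definition realization (d : measure_display) (T : measurableType d)
    (R : realType) (P : probability T R) (k n : nat)
    (z : 'I_k -> 'I_n -> {RV P >-> bool}) (w : T) (j : 'I_k) : 'cV[R]_n :=
  \col_s (z j s w)%:R.

(* Main.v *)
Require Import Defs.
From HB Require Import structures.
From mathcomp Require Import all_boot all_order all_algebra.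
From mathcomp Require Import all_classical all_reals all_analysis.

Set Implicit Arguments.
Unset Strict Implicit.
Unset Printing Implicit Defensive.

Import Order.TTheory GRing.Theory Num.Theory.

Local Open Scope classical_set_scope.
Local Open Scope ring_scope.

(** The two masks have disjoint supports at every outcome: if [i < j], a coordinate kept by mask [i]
    has [z i] equal to 1 there, which kills the factor [1 - z i] of mask [j]. The inner product is a
    sum over coordinates, and each term contains the product of the two mask entries
    ([dropout_mask_disjoint]), so it vanishes whatever the updates are. *)

Lemma hadamardE (R : pzRingType) (m : nat) (u v : 'cV[R]_m) (s : 'I_m) (t : 'I_1) :
  hadamard u v s t = u s t * v s t.
Proof. by rewrite mxE. Qed.

Lemma dropout_maskE (R : realType) (k n : nat) (z : 'I_k -> 'cV[R]_n)
    (j : 'I_k) (s : 'I_n) (t : 'I_1) :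
  dropout_mask z j s t =
  (\prod_(l < k | (l < j)%N) (1 - z l s t)) * z j s t.
Proof.
rewrite hadamardE; congr (_ * _).
(* Entry extraction carries the iterated [hadamard] product to the scalar one: both are built in
   parallel, from the all-ones column and from 1. *)
elim/big_rec2: _ => [|l x u _ <-]; first by rewrite mxE.
by rewrite hadamardE !mxE.
Qed.

(* For [i < j] the factor [1 - z i] of the [j]-th mask meets the factor [z i]
   of the [i]-th one, and [x * (1 - x) = 0] for [x] in {0, 1}. *)
Lemma dropout_mask_disjoint (R : realType) (k n : nat) (z : 'I_k -> 'cV[R]_n)
    (i j : 'I_k) (s : 'I_n) (t : 'I_1) :
  (i < j)%N -> z i s t = 0 \/ z i s t = 1 ->
  dropout_mask z j s t * dropout_mask z i s t = 0.
Proof.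
move=> ij zi; rewrite !dropout_maskE (bigD1 i) //=.
by case: zi => ->; rewrite ?subrr ?mul0r ?mulr0.
Qed.

Theorem theorem2 (R : realType) (k din dout : nat)
    (hk : (1 <= k)%N) (hdin : (1 <= din)%N) (hdout : (1 <= dout)%N)
    (p : 'I_k -> R) (hp : forall j : 'I_k, 0 <= p j < 1)
    (hsum : \sum_(j < k) (1 - p j) <= 1)
    (DW : 'I_k -> 'M[R]_(dout, din)) (h : 'cV[R]_din)
    (d : measure_display) (T : measurableType d) (P : probability T R)
    (z : 'I_k -> 'I_dout -> {RV P >-> bool})
    (hindep : mutually_independent (fun js : 'I_k * 'I_dout => z js.1 js.2))
    (hber : forall (j : 'I_k) (s : 'I_dout),
       distribution P (z j s) = bernoulli_prob (mask_rate p j)) :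
  forall i j : 'I_k, (i < j)%N ->
  forall w : T,
    (hadamard (dropout_mask (realization z w) j) (DW j *m h))^T
      *m hadamard (dropout_mask (realization z w) i) (DW i *m h) = 0.
Proof.
move=> i j ij w; apply/matrixP => a b; rewrite !ord1 !mxE big1 // => s _.
(* [mulrACA] pairs mask with mask and update with update; what remains is that an entry of
   [realization], a cast boolean, is 0 or 1. *)
rewrite mxE !(hadamardE (dropout_mask _ _)) mulrACA dropout_mask_disjoint ?mul0r // mxE.
by case: (z i s w); [right | left].
Qed.
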